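(* Let $R$ be a commutative ring with unity and $(G,\alpha)$ an edge-labeled graph over $R$. Suppose $H$ is a subgraph of $G$ with vertices $h_1,\dots,h_n$ such that each connected component of the graph $G-E(H)$ (obtained from $G$ by deleting the edges of $H$) contains exactly one vertex of $H$; let $G_i$ be the component of $G-E(H)$ containing $h_i$. Then $S(G)$ is the internal direct sum $$S(G)=\langle \mathbbm{1}_G\rangle\oplus \widetilde{S}(H;h_1)\oplus\widetilde{S}(G_1;h_1)\oplus\cdots\oplus\widetilde{S}(G_n;h_n).$$
   Context: An edge labeling of a graph $G=(V,E)$ over $R$ is a function $\alpha:E\to I(R)$ to the set of ideals of $R$. A spline on $(G,\alpha)$ is a function $p:V\to R$ with $p(u)-p(v)\in\alpha(uv)$ for every edge $uv$; $S(G)$ is the ring/$R$-module of splines, and subgraphs carry the restricted labeling. For a vertex $v$ of a graph $K$, $S(K;v)$ is the set of splines $p$ on $K$ with $p(v)=0$. $\mathbbm{1}_G$ is the constant spline with value $1$, and $\langle\mathbbm{1}_G\rangle$ the submodule it generates. Any spline $p$ on $H$ extends to a spline $\widetilde p$ on $G$ taking the constant value $p(h_i)$ on all of $G_i$; $\widetilde{S}(H;h_1)$ is the set of such extensions of splines in $S(H;h_1)$. Any spline $p$ on $G_i$ with $p(h_i)=0$ extends to a spline $\widetilde p$ on $G$ by setting it to $0$ off $G_i$; $\widetilde{S}(G_i;h_i)$ is the set of such extensions of splines in $S(G_i;h_i)$. *)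

(* Defs.v *)
From mathcomp Require Import all_boot all_algebra.
From mathcomp Require Import boolp classical_sets functions.
From Stdlib Require Import Relation_Operators.

Set Implicit Arguments.
Unset Strict Implicit.
Unset Printing Implicit Defensive.

Import GRing.Theory.
Local Open Scope classical_set_scope.
Local Open Scope ring_scope.

(* Simple graphs whose vertices are taken from an ambient type [T], so that a
   graph and its subgraphs live in the same type.  An edge [uv] is the unordered
   pair [set u; v].  Neither [vertices] nor [edges] has to be finite. *)
Record graph (T : Type) := Graph {
  vertices : set T;
  edges : set (set T);
  edgesP : forall e, edges e ->
    exists u v, [/\ vertices u, vertices v, u <> v & e = [set u; v]]
}.

Definition subgraph T (H G : graph T) : Prop :=
  vertices H `<=` vertices G /\ edges H `<=` edges G.

Section EdgeDeletion.
Variables (T : Type) (G : graph T) (F : set (set T)).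

Fact delete_edgesP e : (edges G `\` F) e ->
  exists u v, [/\ vertices G u, vertices G v, u <> v & e = [set u; v]].
Proof. by case=> Ge _; exact: edgesP. Qed.

Definition delete_edges : graph T := Graph delete_edgesP.

End EdgeDeletion.

Section Components.
Variables (T : Type) (K : graph T).

Definition adjacent (u v : T) : Prop := edges K [set u; v].

Definition connected (u v : T) : Prop := clos_refl_trans T adjacent u v.

Variable v : T.

Definition component_vertices : set T := [set u | vertices K u /\ connected v u].
Definition component_edges : set (set T) :=
  [set e | edges K e /\ e `<=` component_vertices].

Fact component_edgesP e : component_edges e ->
  exists a b,
    [/\ component_vertices a, component_vertices b, a <> b & e = [set a; b]].
Proof.
case=> /edgesP [a [b [_ _ ab ->]]] sub.
by exists a, b; split=> //; apply: sub; [left | right].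
Qed.

(* Meaningful only when [v] is a vertex of [K]. *)
Definition component : graph T := Graph component_edgesP.

End Components.

Definition is_component T (K C : graph T) : Prop :=
  exists2 v, vertices K v & C = component K v.

(* Not the library's [idealr_closed], which only covers proper ideals. *)
Definition is_ideal (R : comPzRingType) (I : set R) : Prop :=
  [/\ I 0,
      forall a b, I a -> I b -> I (a + b)
    & forall r a, I a -> I (r * a)].

(* The values of [alpha] outside [edges G] are irrelevant, so the restriction
   of [alpha] to a subgraph is [alpha] itself. *)
Definition edge_labeling (R : comPzRingType) T (G : graph T)
    (alpha : set T -> set R) : Prop :=
  forall e, edges G e -> is_ideal (alpha e).

Section Splines.
Variables (R : comPzRingType) (T : Type) (alpha : set T -> set R).

Definition spline (K : graph T) : set (vertices K -> R^o) :=
  [set p | forall u v : vertices K, edges K [set val u; val v] ->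
     alpha [set val u; val v] (p u - p v)].

(* S(K; v) *)
Definition based_spline (K : graph T) (v : T) : set (vertices K -> R^o) :=
  [set p | spline (K := K) p /\ exists2 w : vertices K, val w = v & p w = 0].

(* The extensions to [G] of the splines in S(H; v): a spline [p] on [H] is
   extended by the constant [p w] on the component of [G - E(H)] containing
   the vertex [w] of [H]. *)
Definition constant_extension (G H : graph T) (v : T) :
    set (vertices G -> R^o) :=
  [set q | exists2 p : vertices H -> R^o, based_spline v p &
     forall (w : vertices H) (u : vertices G),
       vertices (component (delete_edges G (edges H)) (val w)) (val u) ->
       q u = p w].

(* The extensions by zero to [G] of the splines in S(K; v). *)
Definition zero_extension (G K : graph T) (v : T) :
    set (vertices G -> R^o) :=
  [set q | exists2 p : vertices K -> R^o, based_spline v p &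
     (forall (w : vertices K) (u : vertices G), val u = val w -> q u = p w) /\
     (forall u : vertices G, ~ vertices K (val u) -> q u = 0)].

Definition one_spline (G : graph T) : vertices G -> R^o := fun=> 1.

End Splines.

Arguments spline {R T} alpha K.
Arguments based_spline {R T} alpha K v.
Arguments constant_extension {R T} alpha G H v.
Arguments zero_extension {R T} alpha G K v.
Arguments one_spline R {T} G.

Section DirectSum.
Variables (R : pzRingType) (U : lmodType R).

Definition submodule (N : set U) : Prop :=
  [/\ N 0,
      forall x y, N x -> N y -> N (x + y)
    & forall (a : R) x, N x -> N (a *: x)].

Definition generated (x : U) : set U := smallest submodule [set x].

Definition internal_direct_sum (I : finType) (M : set U) (N : I -> set U) :
    Prop :=
  [/\ submodule M,
      forall i, submodule (N i),
      forall i, N i `<=` M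
    & forall x, M x ->
        exists! y : {ffun I -> U}, (forall i, N i (y i)) /\ x = \sum_i y i].

End DirectSum.

Section Summands.
Variables (R : comPzRingType) (T : Type) (alpha : set T -> set R).
Variables (G H : graph T) (n : nat) (h : 'I_n.+1 -> T).

(* <1_G>, S~(H; h_1), and S~(G_i; h_i) for every i; h_1 is [h ord0]. *)
Definition summand (k : option (option 'I_n.+1)) : set (vertices G -> R^o) :=
  match k with
  | None => generated (one_spline R G)
  | Some None => constant_extension alpha G H (h ord0)
  | Some (Some i) =>
      zero_extension alpha G (component (delete_edges G (edges H)) (h i)) (h i)
  end.

End Summands.

Arguments summand {R T} alpha G H {n} h k.

(* Main.v *)
(** For a vertex [u] of [G] let [h (r u)] be the vertex of [H] in the component
   of [G - E(H)] containing [u].  An edge of [G] outside [H] joins two vertices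
   with the same [r], whereas on [H] the map [u |-> h (r u)] is the identity.
   Hence the only candidate for the decomposition of a spline [x], obtained by
   evaluating first at [h_1], then on [H], then everywhere,
     x u = x h_1 + (x (h (r u)) - x h_1) + (x u - x (h (r u))),
   is made of splines, the last term being split according to [r u]. *)
Require Import Defs.
From mathcomp Require Import all_boot all_algebra.
From mathcomp Require Import boolp classical_sets functions.
From Stdlib Require Import Relation_Operators.
Local Open Scope classical_set_scope.

Set Implicit Arguments.
Unset Strict Implicit.
Unset Printing Implicit Defensive.

Import GRing.Theory.
Local Open Scope ring_scope.

(** * Preliminaries on paths, splines and constant functions *)

Lemma connected_sym T (K : graph T) u v : connected K u v -> connected K v u.
Proof.
elim=> [a b ab|a|a b c _ ba _ cb]; last exact: rt_trans cb ba.
  by apply: rt_step; rewrite /adjacent setUC.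
exact: rt_refl.
Qed.

Lemma edge_vertices T (K : graph T) u v :
  edges K [set u; v] -> vertices K u /\ vertices K v.
Proof.
move=> /edgesP[a [b [Ka Kb _ e]]].
(* [edgesP] may return the endpoints in either order, so both are treated through membership in the
   edge. *)
have sub w : [set u; v] w -> vertices K w by rewrite e => -[] ->.
by split; apply: sub; [left | right].
Qed.

Lemma spline_submodule (R : comPzRingType) T (G : graph T)
    (alpha : set T -> set R) :
  edge_labeling G alpha -> submodule (spline alpha G).
Proof.
move=> lab; split=> [u v uv|x y Sx Sy u v uv|a x Sx u v uv].
- by rewrite subrr; case: (lab _ uv).
- case: (lab _ uv) => _ ID _; rewrite !fctE opprD addrACA.
  by apply: ID; [exact: Sx | exact: Sy].
- case: (lab _ uv) => _ _ IM; rewrite !fctE -[_ - _]scalerBr.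
  by apply: IM; exact: Sx.
Qed.

Lemma generated_one_splineE (R : comPzRingType) T (G : graph T)
    (q : vertices G -> R^o) :
  generated (one_spline R G) q <-> exists c : R, forall u, q u = c.
Proof.
split=> [gq|[c qc] N [[_ _ NZ] N1]]; last first.
  have -> : q = c *: one_spline R G.
    by apply: funext => u; rewrite qc fctE; exact/esym/mulr1.
  by apply: NZ; apply: N1.
(* The constant functions form a submodule containing the generator, so the minimality of
   [generated] applies to them. *)
pose C : set (vertices G -> R^o) := [set q | exists c : R, forall u, q u = c].
apply: (gq C); split=> [|_ ->]; last by exists 1.
split=> [|x y [c xc] [d yd]|a x [c xc]].
- by exists 0.
- by exists (c + d) => u; rewrite fctE xc yd.
- by exists (a * c) => u; rewrite fctE xc.
Qed.

Lemma big_option (V : nmodType) (I : finType) (F : option I -> V) :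
  \sum_k F k = F None + \sum_i F (Some i).
Proof.
rewrite (bigD1 None) //= (reindex_omap Some id) => [|[]] //.
by congr (_ + _); apply: eq_bigl => i; rewrite /= eqxx.
Qed.

(** * Splines on a graph with one root in each component of [G] minus the edges of [H] *)

Section Rooted.
Variables (R : comPzRingType) (T : Type) (G H : graph T).
Variables (alpha : set T -> set R) (n : nat) (h : 'I_n.+1 -> T).
Variables (r : vertices G -> 'I_n.+1) (b : 'I_n.+1 -> vertices G).
Hypothesis lab : edge_labeling G alpha.
Hypothesis HG : subgraph H G.
Hypothesis vertH : vertices H = range h.
Hypothesis val_b : forall i, val (b i) = h i.
Hypothesis rb : forall i, r (b i) = i.
(** Holds both halves of the assumption on components: the root of index [r u] reaches [u], and no
    other root does. *)
Hypothesis rP : forall u i,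
  connected (delete_edges G (edges H)) (h i) (val u) <-> r u = i.

Let D := delete_edges G (edges H).

Lemma edge_cases (u v : vertices G) : edges G [set val u; val v] ->
  [/\ edges H [set val u; val v], b (r u) = u & b (r v) = v] \/
  edges D [set val u; val v] /\ r u = r v.
Proof.
move=> Guv; have [Huv|nHuv] := pselect (edges H [set val u; val v]).
  left; have inH (w : vertices G) : vertices H (val w) -> b (r w) = w.
    rewrite vertH => -[i _ hi].
    have -> : w = b i by apply: val_inj; rewrite val_b.
    by rewrite rb.
  by have [Hu Hv] := edge_vertices Huv; split=> //; exact: inH.
(* A path from [h (r u)] to [u] avoiding the edges of [H] extends along this edge to [v]. *)
right; split=> //; apply/esym/rP.
by apply: rt_trans (rt_step _ _ _ _ _); [exact/rP/erefl | split].
Qed.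

Lemma mem_component (u : vertices G) i :
  vertices (component D (h i)) (val u) <-> r u = i.
Proof. by split=> [[_ /rP]|/rP uP] //; split=> //; exact: set_valP. Qed.

Lemma component_edge (u v : vertices G) : edges D [set val u; val v] ->
  r u = r v -> edges (component D (h (r u))) [set val u; val v].
Proof.
by move=> Duv ruv; split=> // w [] ->; apply/mem_component; rewrite ?ruv.
Qed.

(** Describes this summand inside the functions on [G], without reference to a spline on [H]. An
    edge of [H] inherits its condition from that spline, and [q] does not change along any other
    edge; conversely, [q] is restricted to [H]. *)
Lemma constant_extensionE (q : vertices G -> R^o) :
  constant_extension alpha G H (h ord0) q <->
  [/\ spline alpha G q, q (b ord0) = 0 & forall u, q u = q (b (r u))].
Proof.
split=> [[p [Sp [w0 w0E pw0]] qp]|[Sq q0 qE]].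
  have Hh i : vertices H (h i) by rewrite vertH; exists i.
  pose w i : vertices H := SigSub (mem_set (Hh i)).
  have qw u : q u = p (w (r u)) by apply: qp; apply/mem_component.
  split=> [u v Guv||u]; last by rewrite !qw rb.
    have [[Huv bu bv]|[_ ruv]] := edge_cases Guv.
      have wE (u' : vertices G) : b (r u') = u' -> val (w (r u')) = val u'.
        by move=> {2}<-; rewrite val_b.
      rewrite !qw -(wE u bu) -(wE v bv); apply: Sp.
      by rewrite (wE u bu) (wE v bv).
    by rewrite !qw ruv subrr; case: (lab Guv).
  by rewrite qw rb -pw0; congr p; apply: val_inj.
pose f (w : vertices H) : vertices G :=
  SigSub (mem_set (HG.1 _ (set_valP w))).
have fb (w : vertices H) i : val w = h i -> f w = b i.
  by move=> wi; apply: val_inj; rewrite val_b.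
have Hh0 : vertices H (h ord0) by rewrite vertH; exists ord0.
exists (q \o f).
  split=> [u v Huv|]; first exact: (Sq (f u) (f v) (HG.2 _ Huv)).
  by exists (SigSub (mem_set Hh0)) => //=; rewrite (fb _ ord0).
move=> w u; have := set_valP w; rewrite {1}vertH => -[i _ wi].
by rewrite -wi => /mem_component ri; rewrite qE ri /= (fb w i).
Qed.

(** An extension by zero vanishes at every root: at [h i] because the spline is based there, at the
    others because they lie in other components. This settles the edges of [H]; any other edge stays
    in one component, where [q] is either the given spline or zero. *)
Lemma zero_extensionE i (q : vertices G -> R^o) :
  zero_extension alpha G (component D (h i)) (h i) q <->
  [/\ spline alpha G q, q (b i) = 0 & forall u, r u != i -> q u = 0].
Proof.
split=> [[p [Sp [w0 w0E pw0]] [qp q0]]|[Sq qb q0]].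
  have qr u : r u != i -> q u = 0.
    by move=> /eqP rui; apply: q0 => /mem_component.
  have qbj j : q (b j) = 0.
    have [->|ji] := eqVneq j i; last by apply: qr; rewrite rb.
    by rewrite -pw0; apply: qp; rewrite val_b.
  split=> // u v Guv.
  have [[_ bu bv]|[Duv ruv]] := edge_cases Guv.
    have -> : q u = 0 by rewrite -bu.
    have -> : q v = 0 by rewrite -bv.
    by rewrite subrr; case: (lab Guv).
  have [rui|rui] := eqVneq (r u) i; last first.
    by rewrite !qr -?ruv // subrr; case: (lab Guv).
  have Cu : vertices (component D (h i)) (val u) by apply/mem_component.
  have Cv : vertices (component D (h i)) (val v).
    by apply/mem_component; rewrite -ruv.
  pose cu : vertices (component D (h i)) := SigSub (mem_set Cu).
  pose cv : vertices (component D (h i)) := SigSub (mem_set Cv).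
  rewrite (qp cu u) // (qp cv v) //.
  by apply: (Sp cu cv); have := component_edge Duv ruv; rewrite rui.
have CG w : vertices (component D (h i)) w -> vertices G w by case.
pose f (w : vertices (component D (h i))) : vertices G :=
  SigSub (mem_set (CG _ (set_valP w))).
have Chi : vertices (component D (h i)) (h i).
  by have := (mem_component (b i) i).2 (rb i); rewrite val_b.
exists (q \o f); split.
- by move=> u v [[Guv _] _]; exact: (Sq (f u) (f v) Guv).
- exists (SigSub (mem_set Chi)) => //=.
  by rewrite -qb; congr q; apply: val_inj; rewrite val_b.
- by move=> w u uw; congr q; apply: val_inj.
- by move=> u nCu; apply: q0; apply/eqP => /mem_component.
Qed.

(** By the two descriptions above, the extensions are the splines satisfying certain homogeneous
    linear equations; the span of the constant spline is an intersection of submodules. *)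
Lemma summand_submodule k : submodule (summand alpha G H h k).
Proof.
have [S0 SD SZ] := spline_submodule lab.
case: k => [[i|]|] /=.
- split=> [|x y|a x].
  + exact/zero_extensionE.
  + move=> /zero_extensionE[Sx xb x0] /zero_extensionE[Sy yb y0].
    apply/zero_extensionE; split=> [||u ui]; first exact: SD.
      by rewrite fctE xb yb addr0.
    by rewrite fctE x0 // y0 // addr0.
  + move=> /zero_extensionE[Sx xb x0].
    apply/zero_extensionE; split=> [||u ui]; first exact: SZ.
      by rewrite fctE xb scaler0.
    by rewrite fctE x0 // scaler0.
- split=> [|x y|a x].
  + exact/constant_extensionE.
  + move=> /constant_extensionE[Sx xb xE] /constant_extensionE[Sy yb yE].
    apply/constant_extensionE; split=> [||u]; first exact: SD.
      by rewrite fctE xb yb addr0.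
    by rewrite fctE xE yE.
  + move=> /constant_extensionE[Sx xb xE].
    apply/constant_extensionE; split=> [||u]; first exact: SZ.
      by rewrite fctE xb scaler0.
    by rewrite fctE xE.
- split=> [|x y|a x].
  + by move=> N [[N0 _ _] _].
  + by move=> gx gy N NS; case: (NS) => -[_ ND _] _; apply: ND;
      [exact: gx | exact: gy].
  + by move=> gx N NS; case: (NS) => -[_ _ NZ] _; apply: NZ; exact: gx.
Qed.

Lemma summand_sub k : summand alpha G H h k `<=` spline alpha G.
Proof.
case: k => [[i|]|] q /=.
- by case/zero_extensionE.
- by case/constant_extensionE.
- case/generated_one_splineE=> c qc u v Guv.
  by rewrite !qc subrr; case: (lab Guv).
Qed.

(** * Existence and uniqueness of the decomposition *)

Definition piece (x : vertices G -> R^o) (k : option (option 'I_n.+1)) :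
    vertices G -> R^o := fun u =>
  match k with
  | None => x (b ord0)
  | Some None => x (b (r u)) - x (b ord0)
  | Some (Some i) => if r u == i then x u - x (b (r u)) else 0
  end.

(** Along an edge of [H] both endpoints are roots, so the pieces on the components vanish there and
    the piece from [H] changes exactly as [x] does. Along any other edge the latter is constant, and
    the piece of index [r u] changes as [x] does. *)
Lemma piece_summand x k : spline alpha G x -> summand alpha G H h k (piece x k).
Proof.
move=> Sx; case: k => [[i|]|] /=.
- apply/zero_extensionE; split=> [u v Guv||u /negPf /= ->] //=; last first.
    by rewrite rb eqxx subrr.
  have [I0 _ _] := lab Guv.
  have [[_ bu bv]|[_ ruv]] := edge_cases Guv.
    by rewrite bu bv !subrr !if_same subrr.
  rewrite ruv; case: eqP => _; last by rewrite subrr.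
  by rewrite opprB addrA subrK; exact: Sx.
- apply/constant_extensionE; split=> [u v Guv||u] /=; last by rewrite rb.
    rewrite opprB addrA subrK.
    have [[_ -> ->]|[_ ->]] := edge_cases Guv; first exact: Sx.
    by rewrite subrr; case: (lab Guv).
  by rewrite rb subrr.
- by apply/generated_one_splineE; exists (x (b ord0)).
Qed.

Lemma sum_summands (y : option (option 'I_n.+1) -> vertices G -> R^o) u :
  (\sum_k y k) u = y None u + (y (Some None) u + \sum_i y (Some (Some i)) u).
Proof. by rewrite fct_sumE !big_option. Qed.

Lemma sum_piece x : \sum_k piece x k = x.
Proof.
apply: funext => u; rewrite sum_summands /= -big_mkcond.
(* Only the index [r u] contributes, after which the three terms telescope. *)
rewrite (eq_bigl (pred1 (r u))) => [|i]; last exact: eq_sym.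
by rewrite big_pred1_eq addrA (addrC (x (b ord0))) subrK addrC subrK.
Qed.

(** The system is triangular: at [b ord0] only the constant term survives, at the other roots only
    the term from [H] is added, and elsewhere one further term, of index [r u]. Each is therefore
    read off from values of the sum. *)
Lemma summand_sum_unique y : (forall k, summand alpha G H h k (y k)) ->
  forall k, y k = piece (\sum_k y k) k.
Proof.
move=> Sy.
have /generated_one_splineE[c yc] := Sy None.
have /constant_extensionE[_ yH0 yHE] := Sy (Some None).
have yi i := (zero_extensionE i _).1 (Sy (Some (Some i))).
have sumE u : (\sum_k y k) u = c + (y (Some None) u + y (Some (Some (r u))) u).
  rewrite sum_summands yc (bigD1 (r u)) //= big1 ?addr0 // => i.
  by rewrite eq_sym; case: (yi i) => _ _; apply.
have sumb i : (\sum_k y k) (b i) = c + y (Some None) (b i).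
  by rewrite sumE rb; case: (yi i) => _ -> _; rewrite addr0.
case=> [[i|]|]; apply: funext => u /=.
- case: eqVneq => [<-|ui]; last by case: (yi i) => _ _; apply.
  by rewrite sumE sumb -yHE opprD addrACA subrr add0r addrAC subrr add0r.
- by rewrite !sumb yH0 addr0 -yHE addrAC subrr add0r.
- by rewrite sumb yH0 addr0.
Qed.

End Rooted.

Theorem theorem2p6 (R : comPzRingType) (T : Type) (G H : graph T)
  (alpha : set T -> set R) (n : nat) (h : 'I_n.+1 -> T) :
  edge_labeling G alpha ->
  subgraph H G ->
  injective h ->
  vertices H = range h ->
  (forall C : graph T, is_component (delete_edges G (edges H)) C ->
     exists! v : T, vertices H v /\ vertices C v) ->
  internal_direct_sum (spline alpha G) (summand alpha G H h).
Proof.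
move=> lab HG inj_h vertH comp1; set D := delete_edges G (edges H) in comp1.
have Gh i : vertices G (h i) by apply: HG.1; rewrite vertH; exists i.
have inH i : vertices H (h i) by rewrite vertH; exists i.
(* The assumption is applied to the component of [u], whose paths start at [u]; symmetry of
   [connected] turns them into paths starting at a root. *)
have root (u : vertices G) : exists i, connected D (h i) (val u) /\
    forall j, connected D (h j) (val u) -> j = i.
  have [|v [[Hv [_ uv]] vmin]] := comp1 (component D (val u)).
    by exists (val u) => //; exact: set_valP.
  move: Hv uv vmin; rewrite {1}vertH => -[i _ <-] ui vmin.
  exists i; split=> [|j ju]; first exact: (connected_sym ui).
  (* Uniqueness concerns vertices of [H]; injectivity of [h] carries it over to indices. *)
  by apply/inj_h/esym/vmin; do !split=> //; [exact: Gh | exact: connected_sym].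
have [r rP] := choice root.
pose b i : vertices G := SigSub (mem_set (Gh i)).
have rP' (u : vertices G) i : connected D (h i) (val u) <-> r u = i.
  by split=> [/(rP u).2 //|<-]; exact: (rP u).1.
have val_b i : val (b i) = h i by [].
have rb i : r (b i) = i by apply/rP'; exact: rt_refl.
split.
- exact: spline_submodule.
- exact: summand_submodule val_b rb rP'.
- exact: summand_sub val_b rb rP'.
- move=> x Sx; exists [ffun k => piece r b x k]; split.
    split=> [k|]; first by rewrite ffunE; exact: piece_summand.
    by rewrite -{1}(sum_piece r b x); apply: eq_bigr => k _; rewrite ffunE.
  move=> y [Sy xE]; apply/ffunP => k.
  by rewrite ffunE xE -(summand_sum_unique lab HG vertH val_b rb rP' Sy).
Qed.
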